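(* Let $k$ be an algebraically closed field of characteristic zero and let $\pi : Y \to X$ be a finite morphism between affine varieties over $k$. Then the following properties are equivalent: 1) The morphism $\pi_k : Y(k) \to X(k)$ is bijective. 2) $\pi^*$ is injective and the extension $\pi^* : k[X] \hookrightarrow k[Y]$ is subintegral. 3) The morphism $\pi : Y \to X$ is a homeomorphism for the Zariski topologies. 4) The morphism $\pi_k : Y(k) \to X(k)$ is a homeomorphism for the Zariski topologies.
   Context: An affine variety over $k$ is $X=\operatorname{Spec}(k[X])$ with $k[X]$ a reduced finitely generated $k$-algebra ($X$ need not be irreducible). $X(k)$ is the set of closed points of $X$, with the induced Zariski topology. A morphism $\pi:Y\to X$ induces $\pi^*:k[X]\to k[Y]$; it is finite if $\pi^*$ makes $k[Y]$ a finite $k[X]$-module. $\pi_k$ is the restriction of $\pi$ to $Y(k)\to X(k)$. An integral extension of rings $A\hookrightarrow B$ is subintegral if the induced map $\operatorname{Spec}(B)\to\operatorname{Spec}(A)$ is bijective and, for all $\mathfrak{q}\in\operatorname{Spec}(B)$ with $\mathfrak{p}=\mathfrak{q}\cap A$, the induced map of residue fields $\kappa(\mathfrak{p})\to\kappa(\mathfrak{q})$ is an isomorphism. *)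

(* Defs.v *)
From HB Require Import structures.
From mathcomp Require Import all_boot all_algebra.
From mathcomp Require Import boolp classical_sets functions topology.
From mathcomp Require Import -(notations) mpoly.
From mathcomp Require Import ring.

Set Implicit Arguments.
Unset Strict Implicit.
Unset Printing Implicit Defensive.

Import GRing.Theory.
Local Open Scope ring_scope.
Local Open Scope classical_set_scope.

(* Rings are comPzRingType, so that the zero ring (the empty variety) is
   allowed.  Mathcomp's prime_idealr requires a nonzero ring, hence the
   following definition.  Prime ideals are boolean predicates, which classically
   is no restriction. *)
Section PrimeSpectrum.
Variable A : comPzRingType.

Definition prime_ideal (P : {pred A}) : Prop :=
  [/\ 0 \in P, 1 \notin P,
      forall a, {in P &, forall u v, a * u + v \in P}
    & forall u v, u * v \in P -> (u \in P) || (v \in P)].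

Record Spec := MkSpec {
  ideal_of : A -> bool;
  ideal_ofP : prime_ideal ideal_of }.

Lemma Spec_eq (p q : Spec) : ideal_of p =i ideal_of q -> p = q.
Proof.
case: p q => [P hP] [Q hQ] /= /funext PQ.
have {}PQ : P = Q by exact: PQ.
by case: _ / PQ hQ => hQ; congr MkSpec; exact: Prop_irrelevance.
Qed.

HB.instance Definition _ := gen_eqMixin Spec.
HB.instance Definition _ := gen_choiceMixin Spec.

(* The closed set V(E); the Zariski-open sets are the complements of these. *)
Definition zero_locus (E : set A) : set Spec :=
  [set p | forall a, E a -> a \in ideal_of p].

Definition zariski_open (U : set Spec) : Prop :=
  exists E : set A, U = ~` zero_locus E.

Section IdealOf.
Variable p : Spec.
Local Notation I := (ideal_of p).

Lemma ideal_of0 : 0 \in I. Proof. by have [] := ideal_ofP p. Qed.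
Lemma ideal_of1 : 1 \notin I. Proof. by have [] := ideal_ofP p. Qed.
Lemma ideal_ofD x y : x \in I -> y \in I -> x + y \in I.
Proof. by have [_ _ h _] := ideal_ofP p => /(h 1)/[apply]; rewrite mul1r. Qed.
Lemma ideal_ofMl a x : x \in I -> a * x \in I.
Proof.
have [h0 _ h _] := ideal_ofP p => /(h a)/(_ h0).
by rewrite addr0.
Qed.
Lemma ideal_ofN x : x \in I -> - x \in I.
Proof. by rewrite -mulN1r; exact: ideal_ofMl. Qed.
Lemma ideal_ofM u v : (u * v \in I) = (u \in I) || (v \in I).
Proof.
apply/idP/idP; first by have [_ _ _] := ideal_ofP p; exact.
by case/orP; [rewrite mulrC|]; exact: ideal_ofMl.
Qed.

End IdealOf.

Lemma zariski_openT : zariski_open setT.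
Proof.
exists setT; apply/seteqP; split=> // p _ /(_ 1 I).
by apply/negP; exact: ideal_of1.
Qed.

Lemma zariski_openI : setI_closed zariski_open.
Proof.
move=> _ _ [E ->] [F ->].
exists [set c | exists a b, [/\ E a, F b & c = a * b]].
apply/seteqP; split=> [p [nE nF] h|p h].
- have /existsNP[a /not_implyP[Ea /negP na]] := nE.
  have /existsNP[b /not_implyP[Fb /negP nb]] := nF.
  have : a * b \in ideal_of p by apply: h; exists a, b.
  by rewrite ideal_ofM (negPf na) (negPf nb).
split=> hE; apply: h => _ [a [b [Ea Fb ->]]]; rewrite ideal_ofM.
    by rewrite hE.
  by rewrite (hE b) ?orbT.
Qed.

Lemma zariski_open_bigU (J : Type) (U : J -> set Spec) :
  (forall i, zariski_open (U i)) -> zariski_open (\bigcup_i U i).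
Proof.
move=> /choice[E hE]; exists (\bigcup_i E i).
apply/seteqP; split=> [p [i _]|p nh].
  by rewrite hE => + h; apply=> a Ea; apply: h; exists i.
apply: contrapT => nU; apply: nh => a [i _ Ea]; apply: contrapT => na.
by apply: nU; exists i => //; rewrite hE => /(_ _ Ea).
Qed.

HB.instance Definition _ := isOpenTopological.Build Spec
  zariski_openT zariski_openI zariski_open_bigU.

Definition closed_points : set Spec := [set p | closed [set p]].

End PrimeSpectrum.

Section ResidueField.
Variables (A : comPzRingType) (p : Spec A).

(* A itself, known to be nonzero because it has a prime ideal. *)
Definition nzring_at of Spec A : Type := A.
Local Notation Ap := (nzring_at p).

HB.instance Definition _ := GRing.ComPzRing.on Ap.

Lemma nzring_at1 : (1 : Ap) != 0.
Proof.
by apply: contra (ideal_of1 p) => /eqP e; have := ideal_of0 p; rewrite -[0]e.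
Qed.
HB.instance Definition _ := GRing.PzSemiRing_isNonZero.Build Ap nzring_at1.

Definition ideal_at : {pred Ap} := ideal_of p.

Lemma ideal_at_closed : idealr_closed ideal_at.
Proof. by have [] := ideal_ofP p. Qed.
HB.instance Definition _ := isIdealr.Build Ap ideal_at ideal_at_closed.

Lemma ideal_at_prime : prime_idealr_closed ideal_at.
Proof. by have [] := ideal_ofP p. Qed.
HB.instance Definition _ := isPrimeIdealrClosed.Build Ap ideal_at ideal_at_prime.

Definition quot_at : Type := {ideal_quot ideal_at}.
HB.instance Definition _ := GRing.ComNzRing.on quot_at.

Let unit : pred quot_at := fun x => `[< exists y, y * x = 1 >].
Let inv (x : quot_at) : quot_at :=
  if pselect (exists y, y * x = 1) is left e then projT1 (cid e) else x.

Let mulVx : {in unit, left_inverse 1 inv *%R}.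
Proof. by move=> x /asboolP e; rewrite /inv; case: pselect => // e'; case: cid. Qed.
Let unitPl x y : y * x = 1 -> unit x.
Proof. by move=> e; apply/asboolP; exists y. Qed.
Let invx_out : {in [predC unit], inv =1 id}.
Proof. by move=> x /asboolPn e; rewrite /inv; case: pselect. Qed.

HB.instance Definition _ :=
  GRing.ComNzRing_hasMulInverse.Build quot_at mulVx unitPl invx_out.

Lemma quot_at_integral (x y : quot_at) : x * y = 0 -> (x == 0) || (y == 0).
Proof. exact: Quotient.rquot_IdomainAxiom. Qed.
HB.instance Definition _ :=
  GRing.ComUnitRing_isIntegral.Build quot_at quot_at_integral.

Definition residue_field : Type := {fraction quot_at}.
HB.instance Definition _ := GRing.Field.on residue_field.

End ResidueField.

Section SpecMap.
Variables (A B : comPzRingType) (f : {rmorphism A -> B}).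

Definition contraction (q : Spec B) : {pred A} := [pred a | f a \in ideal_of q].

Lemma contraction_prime q : prime_ideal (contraction q).
Proof.
split; rewrite ?inE ?rmorph0 ?rmorph1 ?ideal_of0 ?ideal_of1 //.
- move=> a u v; rewrite !inE rmorphD rmorphM => hu hv.
  by rewrite ideal_ofD ?ideal_ofMl.
- by move=> u v; rewrite !inE rmorphM ideal_ofM.
Qed.

Definition spec_map (q : Spec B) : Spec A := MkSpec (contraction_prime q).

End SpecMap.

(* An injective morphism of domains extends to the fraction fields by
   u / v |-> g u / g v; injectivity is only used in the lemmas. *)
Section FractionMap.
Variables (R S : idomainType) (g : {rmorphism R -> S}) (g_inj : injective g).

Definition fraction_map (x : {fraction R}) : {fraction S} :=
  FracField.tofrac (g (\n_(repr x))) / FracField.tofrac (g (\d_(repr x))).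

Let g_neq0 u : u != 0 -> FracField.tofrac (g u) != 0.
Proof. by rewrite tofrac_eq0 -(rmorph0 g) (inj_eq g_inj). Qed.

Lemma fraction_split (x : {fraction R}) :
  x = FracField.tofrac (\n_(repr x)) / FracField.tofrac (\d_(repr x)).
Proof.
have d0 : FracField.tofrac (\d_(repr x)) != 0 by rewrite tofrac_eq0 denom_ratioP.
apply: (mulIf d0); rewrite divfK //.
suff H (r : {ratio R}) : \pi_({fraction R})%qT r * FracField.tofrac (\d_r) =
    FracField.tofrac (\n_r) by have := H (repr x); rewrite reprK.
unlock FracField.tofrac; rewrite -[LHS]FracField.pi_mul; apply/eqmodP => /=.
rewrite FracField.equivfE /FracField.mulf /=.
by rewrite !numden_Ratio ?mulf_neq0 ?denom_ratioP ?oner_neq0 // !mulr1 mulrC.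
Qed.

Lemma fraction_map_div u v : v != 0 ->
  fraction_map (FracField.tofrac u / FracField.tofrac v) =
  FracField.tofrac (g u) / FracField.tofrac (g v).
Proof.
move=> v0; set x := _ / _; rewrite /fraction_map.
have dx : \d_(repr x) != 0 by exact: denom_ratioP.
have /eqP := fraction_split x; rewrite /x eqr_div ?tofrac_eq0 // -/x.
rewrite -!tofracM tofrac_eq => /eqP e.
by apply/eqP; rewrite eqr_div ?g_neq0 // -!tofracM -!rmorphM e.
Qed.

Lemma fraction_map_zmod : zmod_morphism fraction_map.
Proof.
move=> x y; rewrite [x in LHS]fraction_split [y in LHS]fraction_split.
have dx : \d_(repr x) != 0 by exact: denom_ratioP.
have dy : \d_(repr y) != 0 by exact: denom_ratioP.
rewrite -mulNr addf_div ?tofrac_eq0 // -tofracN -!tofracM -tofracD.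
rewrite fraction_map_div ?mulf_neq0 // /fraction_map -[X in _ = _ + X]mulNr.
by rewrite addf_div ?g_neq0 // -tofracN -!tofracM -tofracD rmorphD !rmorphM rmorphN.
Qed.

Lemma fraction_map_monoid : monoid_morphism fraction_map.
Proof.
split.
  rewrite -[X in fraction_map X](divr1 1) -tofrac1 fraction_map_div ?oner_neq0 //.
  by rewrite rmorph1 tofrac1 divr1.
move=> x y; rewrite [x in LHS]fraction_split [y in LHS]fraction_split.
have dx : \d_(repr x) != 0 by exact: denom_ratioP.
have dy : \d_(repr y) != 0 by exact: denom_ratioP.
rewrite mulf_div -!tofracM fraction_map_div ?mulf_neq0 // !rmorphM.
by rewrite /fraction_map mulf_div.
Qed.

End FractionMap.

Section ResidueMap.
Variables (A B : comPzRingType) (f : {rmorphism A -> B}) (q : Spec B).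
Local Notation p := (spec_map f q).
Local Open Scope quotient_scope.

Definition quot_map (x : quot_at p) : quot_at q :=
  \pi_({ideal_quot (@ideal_at B q)}) (f (repr x)).

Lemma quot_map_pi (a : A) :
  quot_map (\pi_({ideal_quot (@ideal_at A p)}) a) =
  \pi_({ideal_quot (@ideal_at B q)}) (f a).
Proof.
apply/eqP; rewrite /quot_map -[_ == _]/(_ == _ %[mod {ideal_quot (@ideal_at B q)}]).
rewrite -Quotient.idealrBE -rmorphB.
suff : repr (\pi_({ideal_quot (@ideal_at A p)}) a) - a \in @ideal_at A p by [].
by rewrite Quotient.idealrBE reprK.
Qed.

Lemma quot_map_zmod : zmod_morphism quot_map.
Proof.
elim/quotW => x; elim/quotW => y.
by rewrite -[_ - _]rmorphB !quot_map_pi -rmorphB /= (rmorphB f).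
Qed.

Lemma quot_map_monoid : monoid_morphism quot_map.
Proof.
split; first by rewrite -[1 in LHS](rmorph1 \pi) quot_map_pi (rmorph1 f) rmorph1.
elim/quotW => x; elim/quotW => y.
by rewrite -[_ * _]rmorphM !quot_map_pi -rmorphM /= (rmorphM f).
Qed.

HB.instance Definition _ :=
  GRing.isZmodMorphism.Build (quot_at p) (quot_at q) quot_map quot_map_zmod.
HB.instance Definition _ :=
  GRing.isMonoidMorphism.Build (quot_at p) (quot_at q) quot_map quot_map_monoid.

Lemma quot_map_inj : injective quot_map.
Proof.
elim/quotW => x; elim/quotW => y; rewrite !quot_map_pi => /eqP.
rewrite -[_ == _]/(_ == _ %[mod {ideal_quot (@ideal_at B q)}]).
rewrite -Quotient.idealrBE -rmorphB => h.
by apply/eqP; rewrite -Quotient.idealrBE.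
Qed.

(* The map kappa(p) -> kappa(q) induced by f, where p = f^-1(q). *)
Definition residue_map : residue_field p -> residue_field q :=
  fraction_map quot_map.

HB.instance Definition _ := GRing.isZmodMorphism.Build
  (residue_field p) (residue_field q) residue_map (fraction_map_zmod quot_map_inj).
HB.instance Definition _ := GRing.isMonoidMorphism.Build
  (residue_field p) (residue_field q) residue_map (fraction_map_monoid quot_map_inj).

End ResidueMap.
Arguments residue_map {A B} f q x.

Section Extensions.
Variables (A B : comPzRingType) (f : {rmorphism A -> B}).

Definition finite_ext : Prop :=
  exists n (b : 'I_n -> B),
    forall y, exists a : 'I_n -> A, y = \sum_(i < n) f (a i) * b i.

Definition integral_ext : Prop :=
  forall y, exists n (a : 'I_n -> A),
    y ^+ n + \sum_(i < n) f (a i) * y ^+ i = 0.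

Definition subintegral : Prop :=
  [/\ injective f, integral_ext, bijective (spec_map f)
    & forall q : Spec B, bijective (residue_map f q)].

End Extensions.

(* A finite morphism maps closed points to closed points, hence restricts to
   Y(k) -> X(k). *)
Section ClosedPoints.

Lemma closed_point_max (A : comPzRingType) (p m : Spec A) : closed_points p ->
  {subset ideal_of p <= ideal_of m} -> m = p.
Proof.
move=> /closed_openC[E hE] pm; apply: contrapT => mp.
have : (~` [set p]) m by [].
rewrite hE; apply => a Ea; apply: pm.
have : ~ (~` [set p]) p by apply.
by rewrite hE => /contrapT; exact.
Qed.

Lemma closed_point_inv (A : comPzRingType) (p : Spec A) b : closed_points p ->
  b \notin ideal_of p -> exists c, c * b - 1 \in ideal_of p.
Proof.
move=> pcl bp; apply: contrapT => ninv.
pose K : set A := [set x | exists2 u, u \in ideal_of p & exists c, x = u + c * b].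
pose idl (J : set A) := [/\ forall x y, J x -> J y -> J (x + y),
  forall a x, J x -> J (a * x) & ~ J 1].
have KD x y : K x -> K y -> K (x + y).
  move=> [u hu [c ->]] [v hv [d ->]]; exists (u + v); first exact: ideal_ofD.
  by exists (c + d); rewrite mulrDl addrACA.
have KM a x : K x -> K (a * x).
  move=> [u hu [c ->]]; exists (a * u); first exact: ideal_ofMl.
  by exists (a * c); rewrite mulrDr mulrA.
have K1 : ~ K 1.
  move=> [u hu [c e]]; apply: ninv; exists c.
  by rewrite e opprD addrCA subrr addr0 ideal_ofN.
have Kp x : x \in ideal_of p -> K x.
  by move=> hx; exists x => //; exists 0; rewrite mul0r addr0.
have Kb : K b.
  by exists 0; [exact: ideal_of0|exists 1; rewrite add0r mul1r].
have [F hF totF|J [[JD JM J1] Jmax]] := @Zorn_bigcup A [set J | idl (J `|` K)].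
  split.
  - have U J x : F J -> (J `|` K) x -> (\bigcup_(X in F) X `|` K) x.
      by move=> FJ [Jx|Kx]; [left; exists J|right].
    move=> x y [[J FJ Jx]|Kx] [[L FL Ly]|Ky]; last by right; exact: KD.
    + have [hJ _ _] := hF _ FJ; have [hL _ _] := hF _ FL.
      have [JL|LJ] := totF _ _ FJ FL.
        by apply: (U L) => //; apply: hL; left => //; exact: JL.
      by apply: (U J) => //; apply: hJ; left => //; exact: LJ.
    + by have [h _ _] := hF _ FJ; apply: (U J) => //; apply: h; [left|right].
    + by have [h _ _] := hF _ FL; apply: (U L) => //; apply: h; [right|left].
  - move=> a x [[J FJ Jx]|Kx]; last by right; exact: KM.
    have [_ h _] := hF _ FJ; have [] : (J `|` K) (a * x) by apply: h; left.
      by left; exists J.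
    by right.
  - move=> [[J FJ Jx]|//]; have [_ _ h] := hF _ FJ; apply: h; by left.
pose M := J `|` K.
have Mprime : prime_ideal [pred x | `[< M x >]].
  split.
  - by apply/asboolP; right; apply: Kp; exact: ideal_of0.
  - by apply/asboolP.
  - move=> a u v /asboolP Mu /asboolP Mv; apply/asboolP.
    by apply: JD => //; exact: JM.
  - move=> u v /asboolP Muv; apply: contrapT => /negP; rewrite negb_or.
    move=> /andP[/asboolP nMu /asboolP nMv].
    pose L : set A := [set x | exists2 m, M m & exists c, x = m + c * u].
    have ML x : M x -> L x by move=> Mx; exists x => //; exists 0; rewrite mul0r addr0.
    have LK : L `|` K = L by apply/setUidl => x Kx; apply: ML; right.
    have Lu : L u.
      exists 0; first by right; apply: Kp; exact: ideal_of0.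
      by exists 1; rewrite add0r mul1r.
    apply: (Jmax L).
      split=> [|LJ]; first by move=> x Jx; apply: ML; left.
      by apply: nMu; left; exact: LJ.
    rewrite /= LK; split.
    + move=> x y [m Mm [c ->]] [n Mn [d ->]]; exists (m + n); first exact: JD.
      by exists (c + d); rewrite mulrDl addrACA.
    + move=> a x [m Mm [c ->]]; exists (a * m); first exact: JM.
      by exists (a * c); rewrite mulrDr mulrA.
    + move=> [m Mm [c e]]; apply: nMv; rewrite -[v]mul1r e mulrDl.
      by apply: JD; [rewrite mulrC; exact: JM|rewrite -mulrA; exact: JM].
have e : MkSpec Mprime = p.
  by apply: closed_point_max => // x hx; apply/asboolP; right; exact: Kp.
by move/negP: bp; apply; rewrite -e; apply/asboolP; right.
Qed.

Lemma inv_closed_point (A : comPzRingType) (p : Spec A) :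
  (forall b, b \notin ideal_of p -> exists c, c * b - 1 \in ideal_of p) ->
  closed_points p.
Proof.
move=> inv; rewrite /closed_points /= -openC.
exists [set a | a \in ideal_of p]; congr (~` _); apply/seteqP.
split=> [_ -> a //|m pm]; apply: Spec_eq => b; apply/idP/idP; last exact: pm.
move=> bm; apply: contrapT => /negP /inv[c /pm h].
move/negP: (ideal_of1 m); apply.
rewrite -[1](subKr (c * b)); apply: ideal_ofD; first exact: ideal_ofMl.
exact: ideal_ofN.
Qed.

Lemma closed_points_finite (A B : comPzRingType) (f : {rmorphism A -> B}) :
  finite_ext f -> forall q, closed_points q -> closed_points (spec_map f q).
Proof.
move=> [n [b gen]] q qcl; apply: inv_closed_point => a.
rewrite inE => /(closed_point_inv qcl)[y hy].
(* Nakayama: eliminate the generators one at a time *)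
have elim j : (j <= n)%N -> exists w : A, forall z, exists c : 'I_n -> A,
    f (1 + a * w) * z - \sum_(i < n | (i < n - j)%N) f (c i) * b i \in ideal_of q.
  elim: j => [_|j IHj jn].
    exists 0 => z; have [c ->] := gen z; exists c.
    rewrite mulr0 addr0 rmorph1 mul1r.
    rewrite [X in _ - X](eq_bigl xpredT) => [|i]; last by rewrite subn0 ltn_ord.
    by rewrite subrr ideal_of0.
  have [w hw] := IHj (ltnW jn).
  have kn : (n - j.+1 < n)%N by rewrite ltn_subrL /=; case: (n) jn.
  pose k : 'I_n := Ordinal kn.
  have bigk (c : 'I_n -> A) : \sum_(i < n | (i < n - j)%N) f (c i) * b i =
      f (c k) * b k + \sum_(i < n | (i < n - j.+1)%N) f (c i) * b i.
    rewrite (bigD1 k) /=; last by rewrite subnSK.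
    congr (_ + _); apply: eq_bigl => i.
    rewrite -[(n - j)%N]subnSK // ltnS leq_eqVlt -val_eqE /=.
    by case: ltngtP.
  have [c0 hc0] := hw (y * b k); rewrite bigk in hc0.
  pose u := 1 + a * w; pose t := u - a * c0 k.
  have tE : t = 1 + a * (w - c0 k) by rewrite /t /u mulrBr addrA.
  have ht : f t * b k - \sum_(i < n | (i < n - j.+1)%N) f (a * c0 i) * b i
      \in ideal_of q.
    have -> : \sum_(i < n | (i < n - j.+1)%N) f (a * c0 i) * b i =
        f a * \sum_(i < n | (i < n - j.+1)%N) f (c0 i) * b i.
      by rewrite mulr_sumr; apply: eq_bigr => i _; rewrite rmorphM mulrA.
    have h := ideal_ofD (ideal_ofMl (f a) hc0) (ideal_ofMl (- (f u * b k)) hy).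
    by apply: etrans h; apply: (congr1 (fun x => x \in ideal_of q)); rewrite /t rmorphB rmorphM -/u; ring.
  exists (w + (w - c0 k) + a * w * (w - c0 k)) => z.
  have [c hc] := hw z; rewrite bigk in hc.
  exists (fun i => c k * (a * c0 i) + t * c i).
  have -> : 1 + a * (w + (w - c0 k) + a * w * (w - c0 k)) = t * u.
    by rewrite tE /u; ring.
  have -> : \sum_(i < n | (i < n - j.+1)%N) f (c k * (a * c0 i) + t * c i) * b i =
      f (c k) * (\sum_(i < n | (i < n - j.+1)%N) f (a * c0 i) * b i) +
      f t * (\sum_(i < n | (i < n - j.+1)%N) f (c i) * b i).
    rewrite !mulr_sumr -big_split; apply: eq_bigr => i _ /=.
    by rewrite rmorphD !(rmorphM f) mulrDl !mulrA.
  have h := ideal_ofD (ideal_ofMl (f t) hc) (ideal_ofMl (f (c k)) ht).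
  by apply: etrans h; apply: (congr1 (fun x => x \in ideal_of q)); rewrite rmorphM -/u; ring.
have [w hw] := elim n (leqnn n).
have [c] := hw 1; rewrite big_pred0 => [|i]; last by rewrite subnn ltn0.
rewrite subr0 mulr1 => h.
exists (- w); rewrite inE -[X in X \in _]opprK; apply: ideal_ofN.
by rewrite -rmorphN opprB mulNr opprK [w * a]mulrC.
Qed.

End ClosedPoints.

Definition homeomorphism (S T : topologicalType) (g : S -> T) : Prop :=
  continuous g /\ exists h : T -> S, [/\ cancel g h, cancel h g & continuous h].

Section AffineVarieties.
Variable k : fieldType.

Definition reduced (A : comPzRingType) : Prop :=
  forall (x : A) n, x ^+ n = 0 -> x = 0.

Definition finitely_generated (A : comPzRingType) (s : {rmorphism k -> A}) : Prop :=
  exists n (g : {rmorphism mpoly n k -> A}),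
    (forall c, g (mpolyC n c) = s c) /\ (forall x, exists P, g P = x).

(* X is represented by its coordinate ring k[X], a k-algebra through the
   structure map scalars : k -> k[X]. *)
Record affine_variety := AffineVariety {
  coord_ring : comPzRingType;
  scalars : {rmorphism k -> coord_ring};
  coord_ring_reduced : reduced coord_ring;
  coord_ring_fg : finitely_generated scalars }.

Record affine_morphism (Y X : affine_variety) := AffineMorphism {
  comorphism : {rmorphism coord_ring X -> coord_ring Y};
  comorphism_scalars : forall c, comorphism (scalars X c) = scalars Y c }.

(* points X is X = Spec(k[X]) with its Zariski topology; kpoints X is X(k), the
   subtype of closed points with the induced topology. *)
Definition points (X : affine_variety) : topologicalType := Spec (coord_ring X).

Definition kpoints (X : affine_variety) : topologicalType :=
  (@closed_points (coord_ring X) : Type).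

Section Morphism.
Variables (Y X : affine_variety) (f : affine_morphism Y X).

Definition on_points : points Y -> points X := spec_map (comorphism f).

Definition finite_morphism : Prop := finite_ext (comorphism f).

Definition on_kpoints (f_fin : finite_morphism)
    (y : kpoints Y) : kpoints X :=
  SigSub (mem_set (closed_points_finite f_fin (set_mem (valP y)))).

End Morphism.
End AffineVarieties.

(* Main.v *)
Require Import Defs.
From HB Require Import structures.
From mathcomp Require Import all_boot all_algebra.
From mathcomp Require Import boolp classical_sets functions topology.
From mathcomp Require Import -(notations) mpoly.
From mathcomp Require Import ring.

(** Write [A = k[X]], [B = k[Y]] and [f] for the finite map [A -> B], which is
    integral by the determinant trick ([finite_integral]). Two tools carry the
    proof: lying over and going up for integral maps ([lying_over]), and the
    Nullstellensatz in the form that an element outside a prime of [A] or [B] is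
    nonzero at some k-point on that prime ([affine_enough_points]).

    From a bijection on closed points to subintegrality, there are three things
    to see. The map [f] is injective, since a nonzero function on [X] is nonzero
    at a closed point, which lifts to [Y] ([injective_of_closed_surj]). The map on
    spectra is surjective by lying over, and injective because two primes of [B]
    with the same contraction lie under the same closed points
    ([finite_spec_map_inj]). Finally the residue field extension at [q] is trivial
    ([generic_degree_one]): if [P] is a minimal polynomial over [A] of the class
    of [y], all roots of its specialisation at a general closed point lift to
    values of [y] on the fibre, which is a single point. So the specialisation has
    a single root, with multiplicity the degree [d]; comparing the coefficients of
    degree [d - 1] gives a linear equation for [y] at every such point, therefore
    modulo [q], and its leading coefficient is invertible generically because [d]
    is nonzero in [k]. Comparing these coefficients replaces the usual appeal to
    separability and discriminants.

    An integral extension with bijective map on spectra is a homeomorphism since,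
    by lying over, the map is closed ([integral_homeomorphism]). A homeomorphism
    of spectra restricts to closed points, and a homeomorphism is bijective.

    The Nullstellensatz is proved by adding one variable at a time: a homomorphism
    from [R] to an algebraically closed field extends to [R[T]/p] as soon as it is
    nonzero on a suitable element of [R] ([extend_point]). Both there and for the
    residue fields, divisions over the fraction field of [R/p] are replaced by
    pseudo-divisions in [R[T]] by a polynomial [P] of least degree whose leading
    coefficient is outside [p] ([minimal_in]). *)

Set Implicit Arguments.
Unset Strict Implicit.
Unset Printing Implicit Defensive.

Import GRing.Theory.
Local Open Scope ring_scope.
Local Open Scope classical_set_scope.

(** * Prime ideals avoiding a multiplicative set *)

Definition is_ideal (R : comPzRingType) (I : set R) : Prop :=
  [/\ I 0, forall x y, I x -> I y -> I (x + y)
    & forall a x, I x -> I (a * x)].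

Lemma is_ideal_Spec (R : comPzRingType) (p : Spec R) :
  is_ideal [set x | x \in ideal_of p].
Proof.
split; [exact: ideal_of0|exact: ideal_ofD|exact: ideal_ofMl].
Qed.

(** Krull's lemma: an ideal maximal among those that contain [I] and miss the
    multiplicative set [S] is prime. The last clause records the maximality,
    from which lying over deduces the contraction of [q]. *)
Lemma prime_avoiding (R : comPzRingType) (I S : set R) :
  is_ideal I -> S 1 -> (forall x y, S x -> S y -> S (x * y)) ->
  (forall x, I x -> ~ S x) ->
  exists q : Spec R, [/\ forall x, I x -> x \in ideal_of q,
    forall x, x \in ideal_of q -> ~ S x
    & forall x, x \notin ideal_of q ->
        exists2 u, u \in ideal_of q & exists c, S (u + c * x)].
Proof.
move=> [I0 ID IM] S1 SM IS.
(* The condition bears on J `|` I, which makes it hold for the union of the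
   empty chain as well. *)
pose good (J : set R) :=
  is_ideal (J `|` I) /\ forall x, (J `|` I) x -> ~ S x.
have [F hF totF|J [[[J0 JD JM] JS] Jmax]] := @Zorn_bigcup R good.
  have U J x : F J -> (J `|` I) x ->
      (\bigcup_(X in F) X `|` I) x.
    by move=> FJ [Jx|Ix]; [left; exists J|right].
  split; last first.
    by move=> x [[J FJ Jx]|/IS//]; have [_] := hF _ FJ; apply; left.
  split; first by right.
  - move=> x y [[J FJ Jx]|Kx] [[L FL Ly]|Ky]; last by right; exact: ID.
    + have [[_ hJ _] _] := hF _ FJ; have [[_ hL _] _] := hF _ FL.
      have [JL|LJ] := totF _ _ FJ FL.
        by apply: (U L) => //; apply: hL; left => //; exact: JL.
      by apply: (U J) => //; apply: hJ; left => //; exact: LJ.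
    + by have [[_ h _] _] := hF _ FJ; apply: (U J) => //; apply: h; [left|right].
    + by have [[_ h _] _] := hF _ FL; apply: (U L) => //; apply: h; [right|left].
  - move=> a x [[J FJ Jx]|Kx]; last by right; exact: IM.
    by have [[_ _ h] _] := hF _ FJ; apply: (U J) => //; apply: h; left.
pose M : set R := (J `|` I).
have MM a x : M x -> M (x * a) by rewrite mulrC; exact: JM.
have max x : ~ M x -> exists2 u, M u & exists c, S (u + c * x).
  move=> nMx; apply: contrapT => none.
  pose L : set R := [set z : R | exists2 u, M u & exists c, z = u + c * x].
  have ML z : M z -> L z.
    by move=> Mz; exists z => //; exists 0; rewrite mul0r addr0.
  have LI : (L `|` I = L) by apply/setUidl => z Iz; apply: ML; right.
  apply: (Jmax L).
    split=> [|LJ]; first by move=> z Jz; apply: ML; left.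
    apply: nMx; left; apply: LJ; exists 0 => //.
    by exists 1; rewrite add0r mul1r.
  rewrite /good LI; split; last first.
    by move=> z [u Mu [c ->]] Sz; apply: none; exists u => //; exists c.
  split; first exact: ML.
  - move=> z t [u Mu [c ->]] [v Mv [d ->]]; exists (u + v); first exact: JD.
    by exists (c + d); rewrite mulrDl addrACA.
  - move=> a z [u Mu [c ->]]; exists (a * u); first exact: JM.
    by exists (a * c); rewrite mulrDr mulrA.
have Mprime : prime_ideal [pred x | `[< M x >]].
  split.
  - by apply/asboolP.
  - by apply/asboolP => M1; exact: (JS 1).
  - by move=> a u v /asboolP Mu /asboolP Mv; apply/asboolP/JD => //; exact: JM.
  - move=> u v /asboolP Muv; apply: contrapT => /negP; rewrite negb_or.
    move=> /andP[/asboolP /max[m Mm [c Sc]] /asboolP /max[n Mn [d Sd]]].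
    apply: (JS _ _ (SM _ _ Sc Sd)).
    have -> : (m + c * u) * (n + d * v) =
      m * (n + d * v) + (n * (c * u) + (c * d) * (u * v)) by ring.
    by apply: (JD); [exact: MM|apply: (JD); [exact: MM|exact: JM]].
exists (MkSpec Mprime); split=> [x Ix|x|x].
- by apply/asboolP; right.
- by move/asboolP; exact: JS.
- by move/asboolP => /max[u Mu h]; exists u => //; apply/asboolP.
Qed.

Lemma mem_spec_map (A B : comPzRingType) (f : {rmorphism A -> B}) q a :
  (a \in ideal_of (spec_map f q)) = (f a \in ideal_of q).
Proof. by []. Qed.

Lemma ideal_ofX (R : comPzRingType) (p : Spec R) x n :
  x ^+ n \in ideal_of p -> x \in ideal_of p.
Proof.
elim: n => [|n IHn]; first by rewrite expr0 (negPf (ideal_of1 p)).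
by rewrite exprS ideal_ofM => /orP[].
Qed.

Lemma ideal_of_sum (R : comPzRingType) (p : Spec R) n (F : 'I_n -> R) :
  (forall i, F i \in ideal_of p) -> \sum_i F i \in ideal_of p.
Proof.
move=> h; elim/big_ind: _ => //; [exact: ideal_of0|exact: ideal_ofD].
Qed.

Lemma ideal_ofB (R : comPzRingType) (p : Spec R) x y :
  x \in ideal_of p -> y \in ideal_of p -> x - y \in ideal_of p.
Proof. by move=> hx /ideal_ofN; exact: ideal_ofD. Qed.

Lemma ideal_of_eq (R : comPzRingType) (p : Spec R) x y :
  x - y \in ideal_of p -> (x \in ideal_of p) = (y \in ideal_of p).
Proof.
move=> h; apply/idP/idP => hx.
  by have := ideal_ofB hx h; rewrite opprB addrC subrK.
by have := ideal_ofD h hx; rewrite subrK.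
Qed.

(** Lying over is the case where [I] is zero, going up the case where [I] is a
    prime. Take [q] maximal among the ideals that contain [I] and miss the image
    of the complement of [p]. If some [a] in [p] had [f a] outside [q], then
    [f s = b * f a] modulo [q] for some [s] outside [p], and an integral equation
    of [b], multiplied by a power of [f a], would put a power of [s] into [p]. *)
Lemma lying_over (R B : comPzRingType) (f : {rmorphism R -> B}) (p : Spec R)
    (I : set B) :
  integral_ext f -> is_ideal I -> (forall r, I (f r) -> r \in ideal_of p) ->
  exists q : Spec B, (forall x, I x -> x \in ideal_of q) /\ spec_map f q = p.
Proof.
move=> fint Iid Ip.
pose S : set B := [set b | exists2 s, s \notin ideal_of p & b = f s].
have [||x Ix [s sp e]|q [Iq qS qmax]] := @prime_avoiding B I S Iid.
- by exists 1; rewrite ?ideal_of1 ?rmorph1.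
- move=> _ _ [s sp ->] [t tp ->]; exists (s * t); rewrite ?rmorphM //.
  by rewrite ideal_ofM negb_or sp.
- by move/negP: sp; apply; apply: Ip; rewrite -e.
exists q; split=> //.
have qp a : f a \in ideal_of q -> a \in ideal_of p.
  by move=> faq; apply: contrapT => /negP ap; apply: (qS _ faq); exists a.
apply: Spec_eq => a; rewrite inE /=; apply/idP/idP; first exact: qp.
move=> ap; apply: contrapT => /negP /qmax[u uq [b [s sp e]]].
(* The equation of degree n of b, times (f a)^n, is one of b * f a = f s. *)
have [n [c hc]] := fint b.
have : s ^+ n + \sum_(i < n) c i * a ^+ (n - i) * s ^+ i \in ideal_of p.
  apply: qp; rewrite rmorphD rmorphXn rmorph_sum /=.
  have E i : (f s) ^+ i - (b * f a) ^+ i \in ideal_of q.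
    by rewrite subrXX ideal_ofM -e addrK uq.
  have : (f a) ^+ n * (b ^+ n + \sum_(i < n) f (c i) * b ^+ i) \in ideal_of q.
    by rewrite hc mulr0 ideal_of0.
  rewrite mulrDr mulr_sumr => h; apply: (etrans (ideal_of_eq _) h).
  rewrite opprD addrACA -sumrB; apply: ideal_ofD.
    by rewrite -exprMn [f a * b]mulrC E.
  apply: ideal_of_sum => i; rewrite !rmorphM !rmorphXn /=.
  have -> : f a ^+ n = f a ^+ (n - i) * f a ^+ i.
    by rewrite -exprD subnK // ltnW.
  have -> : f (c i) * f a ^+ (n - i) * f s ^+ i -
      f a ^+ (n - i) * f a ^+ i * (f (c i) * b ^+ i) =
      f (c i) * f a ^+ (n - i) * (f s ^+ i - (b * f a) ^+ i).
    by rewrite exprMn; ring.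
  by rewrite ideal_ofMl.
rewrite (ideal_of_eq (y := s ^+ n)) => [/ideal_ofX|].
  by rewrite (negPf sp).
rewrite addrC addKr; apply: ideal_of_sum => i.
rewrite -[(n - i)%N]prednK ?subn_gt0 // exprS.
have -> (x y z : R) : x * (a * y) * z = x * y * z * a by ring.
exact: ideal_ofMl.
Qed.

(** * Finite morphisms are integral *)

(** Polynomials and characteristic polynomials need a nonzero coefficient ring;
    this equality lets a ring with [1 != 0] be replaced by such a structure. *)
Lemma nontrivial_ring (A : comPzRingType) :
  (1 : A) != 0 -> exists A' : comNzRingType, A = A'.
Proof.
move=> A1; pose A' : comNzRingType :=
  HB.pack (GRing.ComPzRing.sort A) (GRing.PzSemiRing_isNonZero.Build A A1).
by exists A'; rewrite {}/A'; case: A A1 => T [].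
Qed.

(** The determinant trick: multiplication by [y] acts on a finite family of
    generators through a matrix over [A], so the characteristic polynomial of
    that matrix vanishes at [y]. *)
Lemma finite_integral (A B : comPzRingType) (f : {rmorphism A -> B}) :
  finite_ext f -> integral_ext f.
Proof.
have [B0|B1] := eqVneq (1 : B) 0.
  by move=> _ y; exists 0%N, (fun=> 0); rewrite big_ord0 addr0 expr0.
have A1 : (1 : A) != 0.
  by apply: contraNneq B1 => A0; rewrite -(rmorph1 f) A0 rmorph0.
have [A' eA] := nontrivial_ring A1; have [B' eB] := nontrivial_ring B1.
case: _ / (esym eA) f A1 => {A eA} f _.
case: _ / (esym eB) f B1 => {B eB} f _.
move=> [n [b gen]] y.
have /choice[a Ea] i : exists a : 'I_n -> A', y * b i = \sum_j f (a j) * b j.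
  exact: gen.
have [u Eu] := gen 1.
pose M := \matrix_(i, j) a j i; pose D := y%:M - map_mx f M.
pose X := \row_i b i.
have XD : X *m D = 0.
  apply/eqP; rewrite mulmxBr mul_mx_scalar subr_eq0; apply/eqP/rowP => i.
  by rewrite !mxE Ea; apply: eq_bigr => j _; rewrite !mxE mulrC.
have detX : \det D *: X = 0.
  by rewrite -mul_mx_scalar -mul_mx_adj mulmxA XD mul0mx.
have det0 : \det D = 0.
  rewrite -[LHS]mulr1 Eu mulr_sumr big1 // => i _.
  by have /rowP/(_ i) := detX; rewrite !mxE mulrCA => ->; rewrite mulr0.
pose P := char_poly M.
have Py : (map_poly f P).[y] = 0.
  rewrite -det0 -horner_evalE -2!det_map_mx; congr (\det _).
  rewrite raddfB /= map_scalar_mx; apply/matrixP => i j.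
  by rewrite !mxE raddfB raddfMn /= map_polyX map_polyC /horner_eval !hornerE.
have sP : size P = n.+1 by exact: size_char_poly.
exists n, (fun i => P`_i); apply: etrans Py.
rewrite (@horner_coef_wide _ n.+1); last by rewrite -sP; exact: size_poly.
rewrite big_ord_recr /= addrC; congr (_ + _).
  have /monicP := char_poly_monic M; rewrite lead_coefE sP /= => e.
  by rewrite coef_map /= /P e rmorph1 mul1r.
by apply: eq_bigr => i _; rewrite coef_map.
Qed.

(** * Homeomorphisms *)

Lemma spec_map_continuous (A B : comPzRingType) (f : {rmorphism A -> B}) :
  continuous (spec_map f).
Proof.
apply/continuousP => _ [E ->]; exists (f @` E).
apply/seteqP; split=> q /= nE h; apply: nE.
  by move=> a Ea; apply: h; exists a.
by move=> _ [a Ea <-]; exact: h.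
Qed.

(** Continuity of the inverse says that [spec_map f] is closed: by lying over,
    the image of [V(E)] consists of the primes that contain the preimage of the
    radical of [E]. *)
Lemma integral_homeomorphism (A B : comPzRingType) (f : {rmorphism A -> B}) :
  integral_ext f -> bijective (spec_map f) -> homeomorphism (spec_map f).
Proof.
move=> fint [h fK hK]; split; first exact: spec_map_continuous.
exists h; split=> //; apply/continuousP => _ [E ->].
exists [set a | forall q : Spec B, zero_locus E q -> f a \in ideal_of q].
apply: (congr1 setC); apply/seteqP; split=> p /= hp.
  by move=> a /(_ _ hp); rewrite -{2}(hK p) inE.
pose I := [set b | forall q : Spec B, zero_locus E q -> b \in ideal_of q].
have Iid : is_ideal I.
  split=> [q _|x y Ix Iy q hq|a x Ix q hq]; first exact: ideal_of0.
    by apply: ideal_ofD; [exact: Ix|exact: Iy].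
  by apply: ideal_ofMl; exact: Ix.
have [q [Iq <-]] := lying_over fint Iid hp.
by rewrite fK => a Ea; apply: Iq => r; exact.
Qed.

(** A homeomorphism and its inverse both preserve closed points, and hence
    restrict to the induced topologies. *)
Lemma homeomorphism_kpoints (k : fieldType) (Y X : affine_variety k)
    (pi : affine_morphism Y X) (pi_fin : finite_morphism pi) :
  homeomorphism (on_points pi) -> homeomorphism (on_kpoints pi_fin).
Proof.
move=> [fc [h [fK hK hc]]].
have hcl (x : points X) : closed_points x -> closed_points (h x).
  move=> xcl; rewrite /closed_points /=.
  have -> : [set h x] = on_points pi @^-1` [set x].
    apply/seteqP; split=> [_ ->|y /= <-]; first exact: hK.
    by rewrite fK.
  by move/continuous_closedP: fc; apply.
split.
  apply: continuous_comp_initial.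
  move=> y; apply: (@continuous_comp (kpoints Y) (points Y) (points X) set_val).
    exact: initial_continuous.
  exact: fc.
exists (fun x : kpoints X => SigSub (mem_set (hcl _ (set_mem (valP x))))).
split.
- by move=> y; apply: val_inj; exact: fK.
- by move=> x; apply: val_inj; exact: hK.
apply: continuous_comp_initial.
move=> x; apply: (@continuous_comp (kpoints X) (points X) (points Y) set_val).
  exact: initial_continuous.
exact: hc.
Qed.

(** * Pseudo-division modulo the contraction of a prime of R[T] *)

Section PolynomialPrime.
Variable R : comNzRingType.

Definition coefs_in (p : Spec R) (G : {poly R}) : Prop :=
  forall i, G`_i \in ideal_of p.

Lemma coefs_in_map (S : nzRingType) (f : {rmorphism R -> S}) (p : Spec R) G :
  (forall a, a \in ideal_of p -> f a = 0) -> coefs_in p G -> map_poly f G = 0.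
Proof. by move=> fp Gp; apply/polyP => i; rewrite coef_map coef0 /= fp. Qed.

Lemma coefs_in_mul (p : Spec R) G H : coefs_in p G -> coefs_in p (G * H).
Proof.
by move=> Gp i; rewrite coefM; apply: ideal_of_sum => j; rewrite mulrC ideal_ofMl.
Qed.

Lemma coefs_inD (p : Spec R) G H :
  coefs_in p G -> coefs_in p H -> coefs_in p (G + H).
Proof. by move=> Gp Hp i; rewrite coefD ideal_ofD. Qed.

Lemma coefs_in_ideal (p : Spec R) (J : set {poly R}) G : is_ideal J ->
  (forall a, a \in ideal_of p -> J a%:P) -> coefs_in p G -> J G.
Proof.
move=> [J0 JD JM] pJ Gp; rewrite -[G]coefK poly_def.
elim/big_ind: _ => // i _.
by rewrite -mul_polyC mulrC; apply: JM; apply: pJ.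
Qed.

(** A polynomial of least degree among the elements of [J] whose leading
    coefficient is outside [p]: it plays the part of a generator of the ideal
    that [J] spans over the fraction field of [R/p]. *)
Definition minimal_in (p : Spec R) (J : set {poly R}) (P : {poly R}) : Prop :=
  [/\ J P, lead_coef P \notin ideal_of p
    & forall G, J G -> (size G < size P)%N -> coefs_in p G].

Lemma minimal_in_ex (p : Spec R) (J : set {poly R}) (G : {poly R}) :
  is_ideal J -> (forall a, a \in ideal_of p -> J a%:P) ->
  J G -> ~ coefs_in p G -> exists P, minimal_in p J P.
Proof.
move=> [J0 JD JM] pJ.
pose good n := exists H, [/\ J H, size H = n & lead_coef H \notin ideal_of p].
(* Leading coefficients that lie in p can be dropped without leaving J. *)
have reduce H : J H -> ~ coefs_in p H -> exists2 n, (n <= size H)%N & good n.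
  have [m] := ubnP (size H); elim: m H => // m IHm H; rewrite ltnS => Hm JH nH.
  have [lH|lH] := boolP (lead_coef H \in ideal_of p); last first.
    by exists (size H) => //; exists H.
  have H0 : (0 < size H)%N.
    rewrite size_poly_gt0; apply/eqP => e; apply: nH => i.
    by rewrite e coef0 ideal_of0.
  pose T := take_poly (size H).-1 H.
  have sT : (size T < size H)%N.
    by rewrite -[ltnRHS](prednK H0) ltnS size_take_poly.
  have TE : T = H - (lead_coef H)%:P * 'X^((size H).-1).
    apply/polyP => i; rewrite coefB coefCM coefXn coef_take_poly lead_coefE.
    have [ilt|ige] := ltnP; first by rewrite (ltn_eqF ilt) mulr0 subr0.
    have [->|ine] := eqVneq; first by rewrite mulr1 subrr.
    rewrite mulr0 subr0 nth_default // -(prednK H0).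
    by rewrite ltn_neqAle eq_sym ine.
  have JT : J T.
    rewrite TE; apply: JD => //; rewrite -mulrN mulrC; apply: JM; exact: pJ.
  have nT : ~ coefs_in p T.
    move=> cT; apply: nH; have -> : H = T + (lead_coef H)%:P * 'X^((size H).-1).
      by rewrite TE subrK.
    apply: coefs_inD => //; apply: coefs_in_mul => i; rewrite coefC.
    by case: ifP => // _; exact: ideal_of0.
  have [n nT' gn] := IHm T (leq_trans sT Hm) JT nT.
  by exists n => //; apply: leq_trans nT' (ltnW sT).
move=> JG nG; have [n _ gn] := reduce G JG nG.
have exg : exists n, (fun n => `[< good n >]) n by exists n; exact/asboolP.
case: (ex_minnP exg) => m /asboolP[P [JP sP lP]] mmin.
exists P; split=> // H JH HP; apply: contrapT => /(reduce _ JH)[j jH gj].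
by have := mmin j (asboolT gj); rewrite -sP leqNgt (leq_ltn_trans jH HP).
Qed.

Lemma minimal_in_neq0 p J P : minimal_in p J P -> P != 0.
Proof.
by case=> _ lP _; apply: contraNneq lP => ->; rewrite lead_coef0 ideal_of0.
Qed.

(** By minimality, the remainder of the pseudo-division of an element of [J] by
    [P] vanishes modulo [p]. The bound on [H * P] will control the degree of [H]
    over a domain. *)
Lemma minimal_in_div (p : Spec R) (J : set {poly R}) P G :
  is_ideal J -> minimal_in p J P -> J G ->
  exists e H, (size (H * P)%R <= maxn (size G) (size P))%N /\
    coefs_in p (lead_coef P ^+ e *: G - H * P).
Proof.
move=> [J0 JD JM] Pmin JG; have P0 := minimal_in_neq0 Pmin.
have [JP lP minP] := Pmin.
exists (Pdiv.Ring.rscalp G P), (Pdiv.Ring.rdivp G P).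
have E := Pdiv.ComRing.rdivp_eq P G.
have rE : Pdiv.Ring.rmodp G P = lead_coef P ^+ Pdiv.Ring.rscalp G P *: G
    - Pdiv.Ring.rdivp G P * P by rewrite E addrC addKr.
have sr := Pdiv.Ring.ltn_rmodpN0 G P0.
split; last first.
  rewrite -rE; apply: minP => //; rewrite rE; apply: JD.
    by rewrite -mul_polyC; exact: JM.
  by rewrite -mulNr; exact: JM.
have -> : Pdiv.Ring.rdivp G P * P =
    lead_coef P ^+ Pdiv.Ring.rscalp G P *: G - Pdiv.Ring.rmodp G P.
  by rewrite E addrK.
apply: leq_trans (size_polyD _ _) _; rewrite size_polyN geq_max.
rewrite (leq_trans (size_scale_leq _ _)) ?leq_maxl //=.
by rewrite (leq_trans (ltnW sr)) ?leq_maxr.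
Qed.

(** Where the leading coefficient of [P] does not vanish, [J] and [P] have the
    same zeros above a point of [p], since some power of that coefficient brings
    any [G] of [J] into the ideal of [P] modulo [p]. *)
Lemma minimal_in_root (F : fieldType) (phi : {rmorphism R -> F}) (c : F)
    (p : Spec R) (J : set {poly R}) P G :
  (forall a, a \in ideal_of p -> phi a = 0) ->
  is_ideal J -> minimal_in p J P -> phi (lead_coef P) != 0 ->
  root (map_poly phi P) c -> J G -> root (map_poly phi G) c.
Proof.
move=> phip Jid Pmin lP /rootP Pc JG.
have [e [H [_ /(coefs_in_map phip)]]] := minimal_in_div Jid Pmin JG.
move=> /(congr1 (horner^~ c)); rewrite rmorphB rmorphM /= map_polyZ /=.
rewrite !hornerE Pc mulr0 subr0 rmorphXn => /eqP.
by rewrite mulf_eq0 expf_eq0 (negPf lP) andbF.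
Qed.

Definition contractC (p : Spec {poly R}) : Spec R := spec_map polyC p.

Lemma contractC_in (p : Spec {poly R}) G :
  coefs_in (contractC p) G -> G \in ideal_of p.
Proof. exact: (coefs_in_ideal (is_ideal_Spec p)). Qed.

Lemma minimal_in_nonconstant (p : Spec {poly R}) P :
  minimal_in (contractC p) [set G | G \in ideal_of p] P -> (1 < size P)%N.
Proof.
move=> Pmin; have [Pp lP _] := Pmin.
rewrite ltn_neqAle eq_sym size_poly_gt0 (minimal_in_neq0 Pmin) andbT.
apply: contraNneq lP => P1; have eP := size1_polyC (eq_leq P1).
by rewrite lead_coefE P1 /=; have : P \in ideal_of p := Pp; rewrite {1}eP.
Qed.

End PolynomialPrime.

(** * The Nullstellensatz *)

(** Extending a homomorphism to an algebraically closed field from [R] to the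
    domain [R[T]/p], keeping a given [b] nonzero. If [T] is transcendental, any
    [c] that is not a root of [b] will do. Otherwise [b] divides, modulo [p], a
    nonzero constant [a] of [R], and any root of a minimal polynomial [P]
    of [T] will do, provided that neither [a] nor the leading coefficient of [P]
    is sent to zero. *)
Lemma extend_point (k : closedFieldType) (R : idomainType)
    (p : Spec {poly R}) (b : {poly R}) : b \notin ideal_of p ->
  exists2 a, a \notin ideal_of (contractC p) &
    forall phi : {rmorphism R -> k},
      (forall x, x \in ideal_of (contractC p) -> phi x = 0) -> phi a != 0 ->
      exists c, (forall G, G \in ideal_of p -> (map_poly phi G).[c] = 0) /\
        (map_poly phi b).[c] != 0.
Proof.
set p0 := contractC p => bp.
have pid := is_ideal_Spec p.
have [alg|trans] :=
    pselect (exists2 G, G \in ideal_of p & ~ coefs_in p0 G); last first.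
  have nb : ~ coefs_in p0 b by move/contractC_in; exact/negP.
  have /existsNP[i /negP bi] := nb.
  exists b`_i => // phi phip0 phib.
  have b0 : map_poly phi b != 0.
    by apply: contraNneq phib => e; rewrite -coef_map e coef0.
  have [c cb] := closed_nonrootP _ b0.
  exists c; split=> // G Gp; rewrite (coefs_in_map phip0) ?horner0 //.
  by apply: contrapT => nG; apply: trans; exists G.
have [G Gp nG] := alg.
have [P Pmin] : exists P, minimal_in p0 [set x | x \in ideal_of p] P.
  exact: (minimal_in_ex pid _ Gp nG).
have [Pp lP minP] := Pmin.
pose J : set {poly R} := [set x | exists2 g, g \in ideal_of p &
  exists h, x = g + h * b].
have pJ g : g \in ideal_of p -> J g.
  by move=> gp; exists g => //; exists 0; rewrite mul0r addr0.
have Jb : J b by exists 0; [exact: ideal_of0|exists 1; rewrite add0r mul1r].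
have Jid : is_ideal J.
  split; first exact/pJ/ideal_of0.
    move=> _ _ [g gp [h ->]] [g' gp' [h' ->]]; exists (g + g').
      exact: ideal_ofD.
    by exists (h + h'); rewrite mulrDl addrACA.
  move=> a _ [g gp [h ->]]; exists (a * g); first exact: ideal_ofMl.
  by exists (a * h); rewrite mulrDr mulrA.
have [M Mmin] : exists M, minimal_in p0 J M.
  by apply: (minimal_in_ex Jid _ (pJ _ Gp) nG) => a ap; exact: pJ.
have [JM lM minM] := Mmin.
have M0 := minimal_in_neq0 Mmin; have P0 := minimal_in_neq0 Pmin.
have powM e x : lead_coef M ^+ e * x \in ideal_of p0 -> x \in ideal_of p0.
  by rewrite ideal_ofM => /orP[/ideal_ofX|//]; rewrite (negPf lM).
(* Otherwise M divides P modulo p0, up to a power of its leading coefficient.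
   If M is in p then so is b; if the quotient H is in p, then its degree, less
   than that of P, contradicts the minimality of P. *)
have M1 : size M = 1%N.
  apply/eqP; rewrite eqn_leq size_poly_gt0 M0 andbT leqNgt; apply/negP => M2.
  have [e [H [sH cH]]] := minimal_in_div Jid Mmin (pJ _ Pp).
  have : H * M \in ideal_of p.
    rewrite -[H * M](subKr (lead_coef M ^+ e *: P)).
    by rewrite ideal_ofB ?(contractC_in cH) // -mul_polyC ideal_ofMl.
  rewrite ideal_ofM => /orP[Hp|Mp].
    have cH0 : coefs_in p0 H.
      apply: minP => //; have [->|H0] := eqVneq H 0.
        by rewrite size_poly0 size_poly_gt0.
      have MP : (size M <= size P)%N.
        rewrite leqNgt; apply/negP => PM; move/negP: lP; apply.
        by rewrite lead_coefE; apply: (minM P) => //; exact: pJ.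
      move: sH; rewrite (maxn_idPl MP) size_mul //.
      apply: leq_trans; rewrite -subn1 -addnBA ?(ltnW M2) //.
      by rewrite -[ltnLHS]addn0 ltn_add2l subn_gt0.
    have := coefs_inD cH (coefs_in_mul M cH0); rewrite subrK => /(_ (size P).-1).
    by rewrite coefZ -lead_coefE => /powM; exact/negP.
  have [e' [H' [_ cH']]] := minimal_in_div Jid Mmin Jb.
  have : (lead_coef M ^+ e')%:P * b \in ideal_of p.
    rewrite mul_polyC -[_ *: b](subrK (H' * M)).
    by rewrite ideal_ofD ?(contractC_in cH') // ideal_ofMl.
  rewrite ideal_ofM (negPf bp) orbF => h.
  by move/negP: lM; apply; apply: (ideal_ofX (n := e')).
(* The constant a = g + h * b of p + (b) keeps b from vanishing with p. *)
have [a ea] : exists a, M = a%:P by exists M`_0; exact: size1_polyC (eq_leq M1).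
have la : a \notin ideal_of p0 by move: lM; rewrite ea lead_coefC.
exists (lead_coef P * a); first by rewrite ideal_ofM negb_or lP.
move=> phi phip0; rewrite rmorphM mulf_eq0 negb_or => /andP[phiP phia].
have [c rc] : exists c, root (map_poly phi P) c.
  apply/closed_rootP; rewrite size_map_poly_id0 //.
  by rewrite gtn_eqF // (minimal_in_nonconstant Pmin).
have kill g : g \in ideal_of p -> (map_poly phi g).[c] = 0.
  by move=> gp; apply/rootP; apply: (minimal_in_root phip0 pid Pmin phiP rc gp).
exists c; split=> //.
have [g gp [h e]] := JM; apply: contraNneq phia => bc.
have := congr1 (fun x => (map_poly phi x).[c]) e.
rewrite ea map_polyC hornerC rmorphD rmorphM hornerD hornerM bc kill //.
by rewrite mulr0 addr0 => /= ->.
Qed.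

Section LastVariable.
Variables (k : fieldType) (n : nat).

(** The isomorphism [k[x_1..x_n][T] -> k[x_1..x_n+1]] that sends [T] to the last
    variable; surjectivity is all that the induction on [n] requires. *)
Definition last_var : {poly mpoly n k} -> mpoly n.+1 k :=
  horner_morph (fun a => mulrC (mpolyX k (mnm1 ord_max)) (@mwiden n k a)).

HB.instance Definition _ := GRing.RMorphism.on last_var.

Lemma last_varC a : last_var a%:P = mwiden a.
Proof. exact: horner_morphC. Qed.

Lemma last_varX : last_var 'X = mpolyX k (mnm1 ord_max).
Proof. exact: horner_morphX. Qed.

Lemma last_var_surj (Q : mpoly n.+1 k) : exists G, last_var G = Q.
Proof.
elim/mpolyind: Q => [|c m Q _ _ [G <-]]; first by exists 0; rewrite rmorph0.
suff [H eH] : exists H, last_var H = mpolyX k m.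
  exists ((mpolyC n c)%:P * H + G).
  by rewrite rmorphD rmorphM /= last_varC mwidenC eH mul_mpolyC.
have pows (I : Type) (r : seq I) (F : I -> mpoly n.+1 k) (d : I -> nat) :
    (forall i, exists H, last_var H = F i) ->
    exists H, last_var H = \prod_(i <- r) F i ^+ d i.
  move=> hF; elim/big_ind: _ => [|_ _ [G1 <-] [G2 <-]|i _].
  - by exists 1; rewrite rmorph1.
  - by exists (G1 * G2); rewrite rmorphM.
  - by have [G1 <-] := hF i; exists (G1 ^+ d i); rewrite rmorphXn.
rewrite mpolyXE_id; apply: pows => i.
have [j ->|->] := unliftP ord_max i; last by exists 'X; exact: last_varX.
exists (mpolyX k (mnm1 j))%:P; rewrite last_varC mwidenX mnmwiden1.
by congr (mpolyX _ (mnm1 _)); apply: val_inj; rewrite /= /bump leqNgt ltn_ord.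
Qed.

Definition extend_coords (v : 'I_n -> k) (c : k) (i : 'I_n.+1) : k :=
  if unlift ord_max i is Some j then v j else c.

Lemma meval_mwiden v c a : meval (extend_coords v c) (mwiden a) = meval v a.
Proof.
elim/mpolyind: a => [|d m a _ _ IHa]; first by rewrite mwiden0 !raddf0.
rewrite mwidenD !mevalD IHa mwidenZ !mevalZ mwidenX !mevalX big_ord_recr /=.
rewrite mnmwiden_ordmax expr0 mulr1; congr (_ * _ + _); apply: eq_bigr => i _.
have e : widen_ord (leqnSn n) i = lift ord_max i.
  by apply: val_inj; rewrite /= /bump leqNgt ltn_ord.
by rewrite mnmwiden_widen /extend_coords e liftK.
Qed.

Lemma meval_last_var v c G :
  meval (extend_coords v c) (last_var G) = (map_poly (meval v) G).[c].
Proof.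
elim/poly_ind: G => [|G a IH]; first by rewrite !rmorph0 horner0.
rewrite !rmorphD !rmorphM /= IH last_varX last_varC mevalXU meval_mwiden.
by rewrite /extend_coords unlift_none map_polyX map_polyC !hornerE.
Qed.

End LastVariable.

(** Hilbert's Nullstellensatz, with its two usual forms in one: for [b = 1] it
    gives a zero of [p], and for varying [b] it says that [p] consists of the
    polynomials that vanish on its zeros. *)
Lemma nullstellensatz (k : closedFieldType) n (p : Spec (mpoly n k)) b :
  b \notin ideal_of p ->
  exists v, (forall G, G \in ideal_of p -> meval v G = 0) /\ meval v b != 0.
Proof.
elim: n p b => [|n IHn] p b bp.
  pose v (i : 'I_0) : k := 0.
  have const (G : mpoly 0 k) : G = mpolyC 0 (meval v G).
    elim/mpolyind: G => [|c m G _ _ IHG]; first by rewrite meval0 mpolyC0.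
    have -> : m = mnm0 by apply/mnmP; case.
    by rewrite mevalD mevalZ mpolyX0 meval1 mulr1 mpolyCD -IHG alg_mpolyC.
  exists v; split=> [G Gp|]; last first.
    by apply: contraNneq bp => e; rewrite (const b) e mpolyC0 ideal_of0.
  apply/eqP; apply: contraT => G0; move/negP: (ideal_of1 p); case.
  have := ideal_ofMl (mpolyC 0 (meval v G)^-1) Gp.
  by rewrite {2}(const G) -mpolyCM mulVf.
have [b' eb] := last_var_surj b.
have b'p : b' \notin ideal_of (spec_map (@last_var k n) p).
  by rewrite mem_spec_map /= eb.
have [a ap ext] := @extend_point k _ _ _ b'p.
have [v [v0 va]] := IHn _ _ ap.
have [c [c0 cb]] := ext (meval v) v0 va.
exists (extend_coords v c); split=> [G Gp|]; last by rewrite -eb meval_last_var.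
have [G' eG] := last_var_surj G.
by rewrite -eG meval_last_var c0 // mem_spec_map /= eG.
Qed.

(** * Points of affine varieties *)

Section KernelPoints.

Lemma idomain_zero_prime (F : idomainType) : prime_ideal [pred x : F | x == 0].
Proof.
split; rewrite ?inE ?oner_eq0 //.
- by move=> a u v; rewrite !inE => /eqP -> /eqP ->; rewrite mulr0 addr0.
- by move=> u v; rewrite !inE mulf_eq0.
Qed.

Definition generic_point (F : idomainType) : Spec F :=
  MkSpec (idomain_zero_prime F).

Variables (F : fieldType) (A : comPzRingType).

Definition kernel_point (ev : {rmorphism A -> F}) : Spec A :=
  spec_map ev (generic_point F).

Lemma mem_kernel_point (ev : {rmorphism A -> F}) a :
  (a \in ideal_of (kernel_point ev)) = (ev a == 0).
Proof. by []. Qed.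

Lemma kernel_point_closed (s : {rmorphism F -> A}) (ev : {rmorphism A -> F}) :
  (forall c, ev (s c) = c) -> closed_points (kernel_point ev).
Proof.
move=> evs; apply: inv_closed_point => b; rewrite mem_kernel_point => b0.
exists (s (ev b)^-1).
by rewrite mem_kernel_point rmorphB rmorphM evs mulVf // rmorph1 subrr.
Qed.

End KernelPoints.

Lemma rmorph_factor (R A K : comPzRingType) (g : {rmorphism R -> A})
    (phi : {rmorphism R -> K}) :
  (forall a, exists x, g x = a) -> (forall x, g x = 0 -> phi x = 0) ->
  exists ev : {rmorphism A -> K}, forall x, ev (g x) = phi x.
Proof.
move=> /choice[h hK] ker.
have eq x y : g x = g y -> phi x = phi y.
  move=> e; apply/eqP; rewrite -subr_eq0 -rmorphB; apply/eqP/ker.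
  by rewrite rmorphB e subrr.
pose ev a := phi (h a).
have evB : zmod_morphism ev.
  by move=> a b; rewrite /ev -rmorphB; apply: eq; rewrite rmorphB !hK.
have evM : monoid_morphism ev.
  split; first by rewrite /ev -(rmorph1 phi); apply: eq; rewrite hK rmorph1.
  by move=> a b; rewrite /ev -rmorphM; apply: eq; rewrite rmorphM !hK.
pose ev' : {rmorphism A -> K} := HB.pack ev
  (GRing.isZmodMorphism.Build A K ev evB) (GRing.isMonoidMorphism.Build A K ev evM).
by exists ev' => x; apply: eq; rewrite hK.
Qed.

(** The Jacobson property together with the fact that residue fields at enough
    closed points are [k], expressed through homomorphisms to [k]. *)
Definition enough_points (k : fieldType) (A : comPzRingType)
    (s : {rmorphism k -> A}) : Prop :=
  forall (p : Spec A) b, b \notin ideal_of p ->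
    exists ev : {rmorphism A -> k}, [/\ forall c, ev (s c) = c,
      forall a, a \in ideal_of p -> ev a = 0 & ev b != 0].

Lemma affine_enough_points (k : closedFieldType) (A : comPzRingType)
    (s : {rmorphism k -> A}) : finitely_generated s -> enough_points s.
Proof.
move=> [n [g [gC gsurj]]] p b bp.
have [b' eb] := gsurj b.
have b'p : b' \notin ideal_of (spec_map g p) by rewrite mem_spec_map /= eb.
have [v [v0 vb]] := nullstellensatz b'p.
have [|ev evE] := @rmorph_factor _ _ _ g (meval v) gsurj.
  by move=> x gx; apply: v0; rewrite mem_spec_map /= gx ideal_of0.
exists ev; split=> [c|a ap|]; last by rewrite -eb evE.
  by rewrite -gC evE /= mevalC.
by have [x ex] := gsurj a; rewrite -ex evE /= v0 // mem_spec_map /= ex.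
Qed.

(** * Residue field extensions *)

Lemma inj_surj_bij (S T : Type) (g : S -> T) :
  injective g -> (forall y, exists x, g x = y) -> bijective g.
Proof.
by move=> ginj /choice[h hK]; exists h => // x; apply: ginj; rewrite hK.
Qed.

(** The residue field of [q] is generated as a field by the classes of elements of
    the ring, so it suffices that each of them be a fraction over [A]. *)
Lemma residue_map_bij (A B : comPzRingType) (f : {rmorphism A -> B}) q :
  (forall y, exists2 s, s \notin ideal_of (spec_map f q) &
     exists a, f s * y - f a \in ideal_of q) ->
  bijective (residue_map f q).
Proof.
move=> lin; apply: inj_surj_bij; first exact: fmorph_inj.
pose img x := exists z, residue_map f q z = x.
have img_div x y : img x -> img y -> img (x / y).
  by move=> [z <-] [t <-]; exists (z / t); rewrite rmorphM fmorphV.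
have img_frac (u : quot_at q) : img (FracField.tofrac u).
  move: u; elim/quotW => y; have [s sp [a h]] := lin y.
  pose ps : quot_at (spec_map f q) :=
    (\pi_({ideal_quot (@ideal_at A (spec_map f q))}) s)%qT.
  pose pa : quot_at (spec_map f q) :=
    (\pi_({ideal_quot (@ideal_at A (spec_map f q))}) a)%qT.
  have ps0 : ps != 0.
    apply: contra sp => /eqP; rewrite /ps -(rmorph0 (\pi_({ideal_quot _}))%qT) => /eqP.
    by rewrite -Quotient.idealrBE subr0.
  exists (FracField.tofrac pa / FracField.tofrac ps).
  rewrite /residue_map fraction_map_div //; last exact: quot_map_inj.
  have fps0 : quot_map ps != 0.
    by rewrite -(rmorph0 (@quot_map _ _ f q)) (inj_eq (@quot_map_inj _ _ f q)).
  apply: (canLR (mulfK _)); first by rewrite tofrac_eq0.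
  rewrite -tofracM; congr FracField.tofrac.
  rewrite /= (quot_map_pi f q a) (quot_map_pi f q s) -rmorphM.
  apply/eqP; rewrite -Quotient.idealrBE.
  by rewrite -opprB; apply: ideal_ofN; rewrite mulrC.
move=> x; rewrite [x]fraction_split; apply: img_div; exact: img_frac.
Qed.

(** Any closed point [m] containing [q] contracts to a prime that contains the
    closed point below [q], hence to that closed point itself. *)
Lemma closed_point_above (k : fieldType) (A B : comPzRingType)
    (f : {rmorphism A -> B}) (sB : {rmorphism k -> B}) (q : Spec B) :
  finite_ext f -> enough_points sB -> closed_points (spec_map f q) ->
  exists2 m, closed_points m &
    {subset ideal_of q <= ideal_of m} /\ spec_map f m = spec_map f q.
Proof.
move=> ffin pts qcl; have [ev [evs evq _]] := pts q 1 (ideal_of1 q).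
have qm : {subset ideal_of q <= ideal_of (kernel_point ev)}.
  by move=> b /evq e; rewrite mem_kernel_point e.
exists (kernel_point ev); first exact: kernel_point_closed evs.
split=> //; apply: closed_point_max => // a.
by rewrite !mem_spec_map => /qm.
Qed.

Section PolynomialEvaluation.
Variables (A B : comNzRingType) (f : {rmorphism A -> B}).

Definition poly_eval (y : B) : {poly A} -> B :=
  horner_morph (fun a => mulrC y (f a)).
HB.instance Definition _ y := GRing.RMorphism.on (poly_eval y).

Lemma poly_evalC y a : poly_eval y a%:P = f a.
Proof. exact: horner_morphC. Qed.

Lemma poly_evalX y : poly_eval y 'X = y.
Proof. exact: horner_morphX. Qed.

Lemma poly_eval_integral y : integral_ext f -> integral_ext (poly_eval y).
Proof.
move=> fint z; have [n [a e]] := fint z; exists n, (fun i => (a i)%:P).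
by apply: etrans e; congr (_ + _); apply: eq_bigr => i _; rewrite /= poly_evalC.
Qed.

End PolynomialEvaluation.

(** The class of [y] modulo [q] has degree one over the residue field below. Let
    [P] be a minimal polynomial of [y], of degree [d], with leading coefficient
    [l] and next coefficient [e]. At any k-point of [V(q)] where [l] is nonzero,
    each root [c] of the specialisation of [P] is the value of [y] at a point of
    the same fibre: the kernel of evaluation at [c] is a prime of [A[T]], and
    going up along [T |-> y] applies to it. The fibres being singletons, the
    specialisation is [l (T - y)^d], whence [d l y + e = 0] at all these points,
    and so in the residue field of [q]. As [d] is nonzero in characteristic
    zero, this is the wanted linear equation. *)
Lemma generic_degree_one_nz (k : closedFieldType) (A B : comNzRingType)
    (f : {rmorphism A -> B}) (sA : {rmorphism k -> A}) (sB : {rmorphism k -> B})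
    (q : Spec B) (y : B) :
  [pchar k] =i pred0 -> (forall c, f (sA c) = sB c) ->
  finite_ext f -> enough_points sB ->
  (forall q1 q2, closed_points q1 -> closed_points q2 ->
     spec_map f q1 = spec_map f q2 -> q1 = q2) ->
  exists2 s, s \notin ideal_of (spec_map f q) &
    exists a, f s * y - f a \in ideal_of q.
Proof.
move=> char0 fs ffin ptsB cinj; have fint := finite_integral ffin.
pose K := spec_map (poly_eval f y) q.
have p0E a : (a \in ideal_of (contractC K)) = (f a \in ideal_of q).
  by rewrite /contractC /K !mem_spec_map /= poly_evalC.
pose J := [set G | G \in ideal_of K].
have Jid : is_ideal J by exact: is_ideal_Spec.
have [P Pmin] : exists P, minimal_in (contractC K) J P.
  have [n [c e]] := fint y.
  pose G := 'X^n + \sum_(i < n) (c i)%:P * 'X^i.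
  apply: (@minimal_in_ex _ _ J G) => //.
    rewrite /J /= mem_spec_map rmorphD rmorphXn /= poly_evalX rmorph_sum /=.
    under eq_bigr do rewrite rmorphM rmorphXn /= poly_evalX poly_evalC.
    by rewrite e ideal_of0.
  move=> /(_ n); rewrite coefD coefXn eqxx coef_sum big1 => [|i _].
    by rewrite addr0; exact/negP/ideal_of1.
  by rewrite coefCM coefXn gtn_eqF ?mulr0.
have P1 := minimal_in_nonconstant Pmin.
have [Pp lP _] := Pmin; rewrite p0E in lP.
pose d := (size P).-1; pose l := lead_coef P; pose e := P`_d.-1.
have d0 : (0 < d)%N by rewrite /d -ltnS prednK // ltnW.
exists (d%:R * l).
  rewrite mem_spec_map rmorphM ideal_ofM negb_or lP andbT.
  have dk : d%:R != 0 :> k by have /pcharf0P -> := char0; rewrite -lt0n.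
  apply/negP => /(ideal_ofMl (sB d%:R^-1)).
  by rewrite -(rmorph_nat sA) fs -rmorphM mulVf // rmorph1; exact/negP/ideal_of1.
exists (- e); rewrite rmorphN opprK; apply: contraT => nq.
(* The factor f l keeps the leading coefficient from vanishing at ev. *)
have : f l * (f (d%:R * l) * y + f e) \notin ideal_of q.
  by rewrite ideal_ofM negb_or lP.
move=> /ptsB[ev [evs evq]]; rewrite rmorphM mulf_eq0 negb_or => /andP[evl /eqP[]].
pose phi : {rmorphism A -> k} := ev \o f.
have phip0 a : a \in ideal_of (contractC K) -> phi a = 0.
  by rewrite p0E => /evq.
have roots c : root (map_poly phi P) c -> c = ev y.
  move=> Pc.
  pose evc : {rmorphism {poly A} -> k} := horner_morph (fun a => mulrC c (phi a)).
  have [|q2 [qq2 q2N]] := lying_over (p := kernel_point evc)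
      (poly_eval_integral y fint) (is_ideal_Spec q).
    move=> G Gq; rewrite mem_kernel_point.
    by have := minimal_in_root phip0 Jid Pmin evl Pc Gq.
  have inq2 G : evc G = 0 -> poly_eval f y G \in ideal_of q2.
    by move=> e0; rewrite -mem_spec_map q2N mem_kernel_point e0.
  have q2ev : spec_map f q2 = spec_map f (kernel_point ev).
    apply: Spec_eq => a; rewrite mem_spec_map -(poly_evalC f y) -mem_spec_map q2N.
    by rewrite !mem_spec_map /= horner_morphC.
  have evcl := kernel_point_closed evs.
  have [|m mcl [q2m]] := closed_point_above (q := q2) ffin ptsB.
    by rewrite q2ev; exact: closed_points_finite.
  rewrite q2ev => /(cinj _ _ mcl evcl) mE.
  have : poly_eval f y ('X - (sA c)%:P) \in ideal_of q2.
    apply: inq2; rewrite rmorphB /= horner_morphX horner_morphC /phi /= fs evs.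
    by rewrite subrr.
  move/q2m; rewrite mE mem_kernel_point.
  rewrite rmorphB /= poly_evalX poly_evalC fs rmorphB evs subr_eq0.
  by move/eqP.
have [r Er] := closed_field_poly_normal (map_poly phi P).
have sP : size (map_poly phi P) = size P by rewrite size_map_poly_id0.
have lPE : lead_coef (map_poly phi P) = phi l by rewrite lead_coefE sP coef_map.
have sr : size r = d.
  have := sP; rewrite Er size_scale ?lPE // size_prod_XsubC => sr.
  by rewrite /d -sr.
have all_r z : z \in r -> z = ev y.
  move=> zr; apply: roots; rewrite Er rootZ ?lPE //.
  by rewrite root_prod_XsubC.
have := congr1 (fun Q : {poly k} => Q`_d.-1) Er.
rewrite coef_map coefZ lPE -sr coefPn_prod_XsubC ?sr -?lt0n // (eq_big_seq _ all_r).
rewrite big_const_seq count_predT sr iter_addr_0 => eqe.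
rewrite rmorphD rmorphM -[ev (f e)]/(phi e) -[ev (f (_ * _))]/(phi _) eqe.
by rewrite rmorphM rmorph_nat mulrN -mulr_natr; ring.
Qed.

Lemma generic_degree_one (k : closedFieldType) (A B : comPzRingType)
    (f : {rmorphism A -> B}) (sA : {rmorphism k -> A}) (sB : {rmorphism k -> B})
    (q : Spec B) (y : B) :
  [pchar k] =i pred0 -> (forall c, f (sA c) = sB c) ->
  finite_ext f -> enough_points sB ->
  (forall q1 q2, closed_points q1 -> closed_points q2 ->
     spec_map f q1 = spec_map f q2 -> q1 = q2) ->
  exists2 s, s \notin ideal_of (spec_map f q) &
    exists a, f s * y - f a \in ideal_of q.
Proof.
move=> char0.
have A1 : (1 : A) != 0 by exact: (nzring_at1 (spec_map f q)).
have B1 : (1 : B) != 0 by exact: (nzring_at1 q).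
have [A' eA] := nontrivial_ring A1; have [B' eB] := nontrivial_ring B1.
case: _ / (esym eA) f sA A1 => {A eA} f sA _.
case: _ / (esym eB) f sB q y B1 => {B eB} f sB q y _.
exact: generic_degree_one_nz.
Qed.

(** Two primes with the same contraction lie under the same closed points: a
    closed point [m2] over [q2] has the contraction of some closed point [m3]
    over [q1], and then [m3 = m2]. The Jacobson property makes them equal. *)
Lemma finite_spec_map_inj (k : fieldType) (A B : comPzRingType)
    (f : {rmorphism A -> B}) (sB : {rmorphism k -> B}) :
  finite_ext f -> enough_points sB ->
  (forall q1 q2, closed_points q1 -> closed_points q2 ->
     spec_map f q1 = spec_map f q2 -> q1 = q2) ->
  injective (spec_map f).
Proof.
move=> ffin pts cinj.
have sub q1 q2 : spec_map f q1 = spec_map f q2 ->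
    {subset ideal_of q1 <= ideal_of q2}.
  move=> e b bq1; apply: contraT => /pts[ev [evs evq2 evb]].
  pose m2 := kernel_point ev.
  have m2cl : closed_points m2 := kernel_point_closed evs.
  have [|q3 [q1q3 q3m2]] := lying_over (p := spec_map f m2)
      (finite_integral ffin) (is_ideal_Spec q1).
    move=> a aq1; rewrite mem_spec_map mem_kernel_point evq2 //.
    by rewrite -mem_spec_map -e.
  have [|m3 m3cl [q3m3]] := closed_point_above (q := q3) ffin pts.
    by rewrite q3m2; exact: closed_points_finite.
  rewrite q3m2 => /(cinj _ _ m3cl m2cl) m3E.
  by have := q3m3 b (q1q3 b bq1); rewrite m3E mem_kernel_point (negPf evb).
move=> q1 q2 e; apply: Spec_eq => b; apply/idP/idP; first exact: sub.
exact: (sub _ _ (esym e)).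
Qed.

(** A nonzero element of a reduced ring is nonzero at some point; that point lifts
    along [f], so [f] does not kill the element. *)
Lemma injective_of_closed_surj (k : fieldType) (A B : comPzRingType)
    (f : {rmorphism A -> B}) (sA : {rmorphism k -> A}) :
  reduced A -> enough_points sA ->
  (forall p, closed_points p -> exists q, spec_map f q = p) -> injective f.
Proof.
move=> Ared pts csurj; apply: raddf_inj => a fa0.
apply/eqP; apply: contraT => /eqP a0.
have [||_ _ [m _ <-] [n _ <-]|x -> [n _]|p [_ pS _]] :=
    @prime_avoiding A [set 0] [set a ^+ n | n in setT].
- by split=> [//|_ _ -> ->|c _ ->]; rewrite ?addr0 ?mulr0.
- by exists 0%N => //; rewrite expr0.
- by exists (m + n)%N => //; rewrite exprD.
- by move=> /Ared.
have ap : a \notin ideal_of p by apply/negP => /pS; case; exists 1%N; rewrite ?expr1.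
have [ev [evs _ eva]] := pts _ _ ap.
have [q qE] := csurj _ (kernel_point_closed evs).
by move: eva; rewrite -(mem_kernel_point ev) -qE mem_spec_map fa0 ideal_of0.
Qed.

(** * The equivalence *)

Lemma subintegral_of_bijective (k : closedFieldType) (Y X : affine_variety k)
    (pi : affine_morphism Y X) (pi_fin : finite_morphism pi) :
  [pchar k] =i pred0 -> bijective (on_kpoints pi_fin) ->
  subintegral (comorphism pi).
Proof.
move=> char0 bij; set f := comorphism pi.
have ptsX := affine_enough_points (coord_ring_fg X).
have ptsY := affine_enough_points (coord_ring_fg Y).
have fint := finite_integral pi_fin.
have cinj q1 q2 : closed_points q1 -> closed_points q2 ->
    spec_map f q1 = spec_map f q2 -> q1 = q2.
  move=> c1 c2 e.
  have := @bij_inj _ _ _ bij (SigSub (mem_set c1)) (SigSub (mem_set c2)).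
  move=> inj; suff /inj /(congr1 val) :
    on_kpoints pi_fin (SigSub (mem_set c1)) =
    on_kpoints pi_fin (SigSub (mem_set c2)) by [].
  exact: val_inj.
have csurj p : closed_points p -> exists q, spec_map f q = p.
  move=> pcl; have [h _ hK] := bij.
  exists (val (h (SigSub (mem_set pcl)))).
  by have /(congr1 val) := hK (SigSub (mem_set pcl)).
have finj := injective_of_closed_surj (coord_ring_reduced (a := X)) ptsX csurj.
split=> //.
- apply: inj_surj_bij; first exact: finite_spec_map_inj ptsY cinj.
  move=> p; have [||q [_ qE]] := @lying_over _ _ f p [set 0] fint.
  + by split=> [//|_ _ -> ->|c _ ->]; rewrite ?addr0 ?mulr0.
  + by move=> r; rewrite /= -(rmorph0 f) => /finj ->; exact: ideal_of0.
  + by exists q.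
- move=> q; apply: residue_map_bij => y.
  exact: (generic_degree_one _ _ char0 (comorphism_scalars pi) pi_fin ptsY cinj).
Qed.

Theorem theorem3p1 (k : closedFieldType) (char0 : [pchar k]%R =i pred0)
    (Y X : affine_variety k) (pi : affine_morphism Y X)
    (pi_fin : finite_morphism pi) :
  [<-> bijective (on_kpoints pi_fin);
       injective (comorphism pi) /\ subintegral (comorphism pi);
       homeomorphism (on_points pi);
       homeomorphism (on_kpoints pi_fin)].
Proof.
tfae.
- move=> bij; have sub := subintegral_of_bijective char0 bij.
  by split=> //; case: sub.
- move=> [_ [_ pint pbij _]]; exact: integral_homeomorphism.
- exact: homeomorphism_kpoints.
- by move=> [_ [h [hK Kh _]]]; exists h.
Qed.
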